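(* Let $n\geqslant1$, let $M\in\{\mathrm{PsEnd}(S_n),\mathrm{PswEnd}(S_n),\mathrm{IEnd}(S_n),\mathrm{PEnd}(S_n),\mathrm{PwEnd}(S_n)\}$ and let $\alpha\in M$. Then $\alpha$ is a regular element of $M$ if and only if $0\in\mathrm{Dom}(\alpha)$ or $\mathrm{Im}(\alpha)=\{0\}$ or $0\notin\mathrm{Im}(\alpha)$.
   Context: For $n\geqslant1$, the star graph $S_n$ is the simple graph with vertex set $V=\{0,1,\ldots,n-1\}$ and edge set $E=\{\{0,i\}\mid 1\leqslant i\leqslant n-1\}$. $\mathcal{PT}(V)$ is the monoid of all partial transformations of $V$ (including the empty one) under composition; maps are written on the right and composed left to right. A map $\alpha\in\mathcal{PT}(V)$ is, for a graph $G=(V,E)$, with conditions required for all $u,v\in\mathrm{Dom}(\alpha)$: a partial endomorphism if $\{u,v\}\in E\Rightarrow\{u\alpha,v\alpha\}\in E$; a partial weak endomorphism if $\{u,v\}\in E$ and $u\alpha\ne v\alpha$ imply $\{u\alpha,v\alpha\}\in E$; a partial strong endomorphism if $\{u,v\}\in E\Leftrightarrow\{u\alpha,v\alpha\}\in E$; a partial strong weak endomorphism if ($\{u,v\}\in E$ and $u\alpha\ne v\alpha$) $\Leftrightarrow\{u\alpha,v\alpha\}\in E$. The sets of all these are the submonoids $\mathrm{PEnd}(G)$, $\mathrm{PwEnd}(G)$, $\mathrm{PsEnd}(G)$, $\mathrm{PswEnd}(G)$ of $\mathcal{PT}(V)$, respectively, and $\mathrm{IEnd}(G)$ is the submonoid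 of all injective elements of $\mathrm{PEnd}(G)$. An element $\alpha$ of a monoid $M$ is regular in $M$ if there is $\beta\in M$ with $\alpha=\alpha\beta\alpha$. *)

(* Defs.v *)
From HB Require Import structures.
From mathcomp Require Import all_boot.

Set Implicit Arguments.
Unset Strict Implicit.
Unset Printing Implicit Defensive.

(* Edges are two-element sets, so [set u; u] = [set u] is never an edge. *)
Record sgraph (V : finType) := SGraph {
  edges : {set {set V}};
  edges_card2 : forall e : {set V}, e \in edges -> #|e| = 2
}.

Section StarGraph.
Variables (n : nat) (n_gt0 : 1 <= n).

Definition centre : 'I_n := Ordinal n_gt0.

Definition star_edges : {set {set 'I_n}} :=
  [set [set centre; i] | i : 'I_n & 1 <= i].

Lemma star_edges_card2 (e : {set 'I_n}) : e \in star_edges -> #|e| = 2.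
Proof.
by case/imsetP=> i; rewrite inE => i_gt0 ->; rewrite cards2 -val_eqE /= ltn_eqF.
Qed.

Definition star : sgraph 'I_n := SGraph star_edges_card2.

End StarGraph.

(* a u = None means that u is outside the domain of a. *)
Definition PT (V : finType) : Type := {ffun V -> option V}.

HB.instance Definition _ (V : finType) := Finite.copy (PT V) {ffun V -> option V}.

Section PartialTransformations.
Variable V : finType.
Implicit Types a b c : PT V.

Definition pdom a : {set V} := [set u | isSome (a u)].
Definition pim a : {set V} := [set x | [exists u, a u == Some x]].

(* Left-to-right composition: first a, then b. *)
Definition pcomp a b : PT V := [ffun u => obind b (a u)].
Definition pid : PT V := [ffun u => Some u].

Lemma pcompA : associative pcomp.
Proof. by move=> a b c; apply/ffunP=> u; rewrite !ffunE; case: (a u) => //= x; rewrite ffunE. Qed.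

Lemma pid_comp : left_id pid pcomp.
Proof. by move=> a; apply/ffunP=> u; rewrite !ffunE. Qed.

Lemma pcomp_id : right_id pid pcomp.
Proof. by move=> a; apply/ffunP=> u; rewrite ffunE; case: (a u) => //= x; rewrite ffunE. Qed.

HB.instance Definition _ := isMonoid.Build (PT V) pcompA pid_comp pcomp_id.

(* For all u, v in the domain of a, with images x, y: R u v x y. *)
Definition all_images (R : V -> V -> V -> V -> bool) a : bool :=
  [forall u, forall v, forall x, forall y,
    (a u == Some x) && (a v == Some y) ==> R u v x y].

Lemma all_imagesP (R : V -> V -> V -> V -> bool) a :
  reflect (forall u v x y, a u = Some x -> a v = Some y -> R u v x y)
          (all_images R a).
Proof.
apply: (iffP forallP) => [Ra u v x y au av | Ra u].
  move: (Ra u) => /forallP/(_ v)/forallP/(_ x)/forallP/(_ y).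
  by rewrite au av !eqxx.
apply/forallP=> v; apply/forallP=> x; apply/forallP=> y.
by apply/implyP=> /andP[/eqP au /eqP av]; apply: Ra.
Qed.

End PartialTransformations.

Section Endomorphisms.
Variables (V : finType) (G : sgraph V).

Definition PEnd : {set PT V} :=
  [set a | all_images (fun u v x y =>
    ([set u; v] \in edges G) ==> ([set x; y] \in edges G)) a].

Definition PwEnd : {set PT V} :=
  [set a | all_images (fun u v x y =>
    ([set u; v] \in edges G) && (x != y) ==> ([set x; y] \in edges G)) a].

Definition PsEnd : {set PT V} :=
  [set a | all_images (fun u v x y =>
    ([set u; v] \in edges G) == ([set x; y] \in edges G)) a].

Definition PswEnd : {set PT V} :=
  [set a | all_images (fun u v x y =>
    (([set u; v] \in edges G) && (x != y)) == ([set x; y] \in edges G)) a].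

Definition IEnd : {set PT V} := [set a in PEnd | dinjectiveb a (pdom a)].

Lemma edge_neq u v : [set u; v] \in edges G -> u != v.
Proof. by move/edges_card2; rewrite cards2; case: eqP. Qed.

Lemma pcomp_Some (a b : PT V) u z :
  (a * b)%g u = Some z -> exists2 x, a u = Some x & b x = Some z.
Proof. by rewrite ffunE; case: (a u) => //= x bx; exists x. Qed.

Lemma pid_Some u x : (1%g : PT V) u = Some x -> x = u.
Proof. by rewrite ffunE => -[]. Qed.

Lemma PEnd_monoid_closed : monoid_closed PEnd.
Proof.
split=> [|a b]; rewrite !inE.
  by apply/all_imagesP=> u v x y /pid_Some-> /pid_Some->; rewrite implybb.
move=> /all_imagesP aE /all_imagesP bE; apply/all_imagesP=> u v x y.
move=> /pcomp_Some[x' au bx] /pcomp_Some[y' av by_].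
by apply/implyP=> /(implyP (aE _ _ _ _ au av)) /(implyP (bE _ _ _ _ bx by_)).
Qed.

Lemma PwEnd_monoid_closed : monoid_closed PwEnd.
Proof.
split=> [|a b]; rewrite !inE.
  by apply/all_imagesP=> u v x y /pid_Some-> /pid_Some->; apply/implyP=> /andP[].
move=> /all_imagesP aE /all_imagesP bE; apply/all_imagesP=> u v x y.
move=> /pcomp_Some[x' au bx] /pcomp_Some[y' av by_].
apply/implyP=> /andP[uvE xy]; apply: (implyP (bE _ _ _ _ bx by_)); rewrite xy andbT.
apply: (implyP (aE _ _ _ _ au av)); rewrite uvE /=.
by apply: contra_neq xy => xy'; move: bx; rewrite xy' by_ => -[].
Qed.

Lemma PsEnd_monoid_closed : monoid_closed PsEnd.
Proof.
split=> [|a b]; rewrite !inE.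
  by apply/all_imagesP=> u v x y /pid_Some-> /pid_Some->.
move=> /all_imagesP aE /all_imagesP bE; apply/all_imagesP=> u v x y.
move=> /pcomp_Some[x' au bx] /pcomp_Some[y' av by_].
by rewrite (eqP (aE _ _ _ _ au av)) (eqP (bE _ _ _ _ bx by_)).
Qed.

Lemma PswEnd_monoid_closed : monoid_closed PswEnd.
Proof.
split=> [|a b]; rewrite !inE.
  apply/all_imagesP=> u v x y /pid_Some-> /pid_Some->.
  by apply/eqP; apply: andb_idr => /edge_neq.
move=> /all_imagesP aE /all_imagesP bE; apply/all_imagesP=> u v x y.
move=> /pcomp_Some[x' au bx] /pcomp_Some[y' av by_].
rewrite -(eqP (bE _ _ _ _ bx by_)) -(eqP (aE _ _ _ _ au av)) -andbA.
apply/eqP; congr (_ && _); rewrite andb_idl // => xy.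
by apply: contra_neq xy => xy'; move: bx; rewrite xy' by_ => -[].
Qed.

Lemma IEnd_monoid_closed : monoid_closed IEnd.
Proof.
have [PE1 PEM] := PEnd_monoid_closed.
split=> [|a b]; rewrite [_ \in IEnd]inE.
  rewrite PE1; apply/dinjectiveP=> u v _ _.
  by rewrite !ffunE => -[].
case/andP=> aE /dinjectiveP aI; rewrite inE => /andP[bE /dinjectiveP bI].
rewrite inE PEM //=; apply/dinjectiveP=> u v; rewrite !inE !ffunE.
case au: (a u) => [x|] //=; case av: (a v) => [y|] //= bx by_ bxy.
have xy : x = y by apply: bI; rewrite ?inE.
by apply: aI; rewrite ?inE ?au ?av ?xy.
Qed.

End Endomorphisms.

Definition regular_in (T : monoidType) (M : {pred T}) (a : T) : Prop :=
  exists2 b, b \in M & (a = a * b * a)%g.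

(* Main.v *)
(** Regularity is witnessed by a partial section [b] of [a], with domain
    [Im a], that sends [0a] to [0] whenever [0 \in Dom a].  A section of a
    strong (weak) endomorphism is automatically of the same kind, and a section
    is always injective; on a star, the stated condition and the normalisation
    at [0] make [b] preserve edges.  Conversely, if [0 \in Im a],
    [Im a <> {0}] and [0 \notin Dom a], a quasi-inverse of [a] would map some
    edge [{0, y}] to two distinct vertices of [Dom a], which are both leaves. *)
Require Import Defs.
From mathcomp Require Import all_boot.

Section BasedSection.
Set Implicit Arguments.
Unset Strict Implicit.
Variable V : finType.
Implicit Types a b : PT V.

(** [pick] alone could return any preimage; the first test forces [r] wherever [r] is one. Off the
    image of [a], [pick] gives [None]. *)
Definition based_section (r : V) a : PT V :=
  [ffun y => if a r == Some y then Some r else [pick u | a u == Some y]].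

Lemma based_sectionK r a x u : based_section r a x = Some u -> a u = Some x.
Proof.
rewrite ffunE; case: eqP => [ar [<-] // | _].
by case: pickP => // v /eqP av [<-].
Qed.

Lemma based_section_base r a x : a r = Some x -> based_section r a x = Some r.
Proof. by move=> ar; rewrite ffunE ar eqxx. Qed.

Lemma based_section_im r a u x :
  a u = Some x -> exists v, based_section r a x = Some v.
Proof.
move=> au; rewrite ffunE; case: eqP => _; first by exists r.
by case: pickP => [v _ | /(_ u)]; [exists v | rewrite au eqxx].
Qed.

Lemma based_section_quasi_inverse r a : a = (a * based_section r a * a)%g.
Proof.
apply/ffunP=> u; rewrite 2!ffunE; case au: (a u) => [x|] //=.
by have [v bx] := based_section_im r au; rewrite bx /= (based_sectionK bx).
Qed.

Lemma based_section_inj r a x y u :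
  based_section r a x = Some u -> based_section r a y = Some u -> x = y.
Proof. by move=> /based_sectionK au /based_sectionK; rewrite au => -[]. Qed.

Lemma based_section_neq r a x y u v :
    based_section r a x = Some u -> based_section r a y = Some v ->
  (u != v) = (x != y).
Proof.
move=> bx by_; congr negb; apply/eqP/eqP => [uv | xy].
  by apply: (based_section_inj bx); rewrite uv.
by move: bx; rewrite xy by_ => -[].
Qed.

(** The path of [u] through [a * b * a] visits [x] first, then its image under [b], and must come
    back to [x]. *)
Lemma quasi_inverse_im a b u x :
  a = (a * b * a)%g -> a u = Some x -> exists2 v, b x = Some v & a v = Some x.
Proof.
move=> aba au; have := au; rewrite {1}aba => /pcomp_Some[v + av].
by case/pcomp_Some=> x'; rewrite au => -[<-] bx; exists v.
Qed.

End BasedSection.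

Section EndomorphismClasses.
Set Implicit Arguments.
Unset Strict Implicit.
Variables (V : finType) (G : sgraph V).
Implicit Types a : PT V.

Lemma PEnd_sub_PwEnd : PEnd G \subset PwEnd G.
Proof.
apply/subsetP=> a; rewrite !inE => /all_imagesP aE.
apply/all_imagesP=> u v x y au av; apply/implyP=> /andP[uvE _].
exact: (implyP (aE _ _ _ _ au av)).
Qed.

Lemma PsEnd_sub_PEnd : PsEnd G \subset PEnd G.
Proof.
apply/subsetP=> a; rewrite !inE => /all_imagesP aE.
by apply/all_imagesP=> u v x y au av; rewrite (eqP (aE _ _ _ _ au av)) implybb.
Qed.

Lemma IEnd_sub_PEnd : IEnd G \subset PEnd G.
Proof. by apply/subsetP=> a; rewrite inE => /andP[]. Qed.

Lemma PswEnd_sub_PwEnd : PswEnd G \subset PwEnd G.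
Proof.
apply/subsetP=> a; rewrite !inE => /all_imagesP aE.
by apply/all_imagesP=> u v x y au av; rewrite (eqP (aE _ _ _ _ au av)) implybb.
Qed.

(** The strong condition is an equivalence, hence can be read backwards along chosen preimages. *)
Lemma based_section_PsEnd r a : a \in PsEnd G -> based_section r a \in PsEnd G.
Proof.
rewrite !inE => /all_imagesP aE; apply/all_imagesP=> x y u v.
move=> /based_sectionK au /based_sectionK av.
by rewrite (eqP (aE _ _ _ _ au av)).
Qed.

Lemma based_section_PswEnd r a :
  a \in PswEnd G -> based_section r a \in PswEnd G.
Proof.
rewrite !inE => /all_imagesP aE; apply/all_imagesP=> x y u v bx by_.
have := aE _ _ _ _ (based_sectionK bx) (based_sectionK by_).
rewrite (based_section_neq bx by_) => /eqP <-.
(* What remains is that the ends [u], [v] of an edge are distinct. *)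
by rewrite -andbA andbb -(based_section_neq bx by_) andb_idr // => /edge_neq.
Qed.

Lemma based_section_IEnd r a :
  based_section r a \in PEnd G -> based_section r a \in IEnd G.
Proof.
move=> bE; rewrite inE bE /=; apply/dinjectiveP=> x y; rewrite !inE.
by case bx: (based_section r a x) => [u|] // _ _ /esym/(based_section_inj bx).
Qed.

End EndomorphismClasses.

Section Star.
Set Implicit Arguments.
Unset Strict Implicit.
Variables (n : nat) (n_gt0 : 1 <= n).
Local Notation c := (centre n_gt0).
Local Notation S := (star n_gt0).
Implicit Types (a : PT 'I_n) (u v x y : 'I_n).

(** The exclusive or is symmetric and false for [u = v], so edge questions on a star become
    boolean. *)
Lemma star_edgeE u v : ([set u; v] \in edges S) = (u == c) (+) (v == c).
Proof.
have leafE (i : 'I_n) : (1 <= i) = (i != c) by rewrite lt0n.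
apply/imsetP/idP => [[i] | ].
  rewrite inE leafE => ic E.
  have /set2P[] : u \in [set c; i] by rewrite -E set21.
    have /set2P[ic' | <-] : i \in [set u; v] by rewrite E set22.
      by move=> uc; rewrite ic' uc eqxx in ic.
    by move=> ->; rewrite eqxx (negPf ic).
  have /set2P[cu | <-] : c \in [set u; v] by rewrite E set21.
    by move=> ui; rewrite -ui -cu eqxx in ic.
  by move=> ->; rewrite eqxx (negPf ic).
case: (u =P c) => [-> | /eqP uc] /=; first by exists v; rewrite ?inE ?leafE.
by move/eqP=> ->; exists u; rewrite 1?setUC ?inE ?leafE.
Qed.

Lemma based_section_star_edge a y u v :
    a \in PwEnd S -> c \in pdom a -> y != c ->
    based_section c a c = Some u -> based_section c a y = Some v ->
  (u == c) (+) (v == c).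
Proof.
rewrite !inE => /all_imagesP aE; case ac: (a c) => [z|] // _ yc bc by_.
have [au av] := (based_sectionK bc, based_sectionK by_).
have [uc | uc] /= := eqVneq u c.
  by apply: contraNneq yc => vc; move: av; rewrite vc -[X in a X]uc au => -[<-].
(* Now [u] is a leaf over [c], so [a] cannot fix [c]: the section would then have chosen [c]. *)
have zc : z != c.
  apply: contraNneq uc => zc; rewrite zc in ac.
  by move: bc; rewrite (based_section_base ac) => -[<-].
apply: contraT => vc.
(* If [v] were a leaf, the edge from [c] to [v] would go to the leaves [z] and [y], forcing [z = y];
   but the section sends [z] to [c]. *)
have := aE _ _ _ _ ac av; rewrite !star_edgeE !eqxx (negPf vc) (negPf zc) (negPf yc).
rewrite implybF negbK => /eqP zy.
by rewrite -zy (based_section_base ac) in by_; case: by_ vc => <-; rewrite eqxx.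
Qed.

Definition star_regular a : Prop :=
  c \in pdom a \/ pim a = [set c] \/ c \notin pim a.

(** If [c] is outside the domain of [a], the image of [a] is [{c}] or consists of leaves, so it
    spans no edge and there is nothing to preserve. *)
Lemma based_section_PEnd a :
  a \in PwEnd S -> star_regular a -> based_section c a \in PEnd S.
Proof.
move=> aE a_reg; rewrite inE; apply/all_imagesP=> x y u v bx by_.
have im w z : based_section c a w = Some z -> w \in pim a.
  by move=> /based_sectionK az; rewrite inE; apply/existsP; exists z; rewrite az.
rewrite !star_edgeE; apply/implyP.
case: a_reg => [ca | [a0 | /negP a0]].
- have [xc | xc] := eqVneq x c; have [yc | yc] := eqVneq y c => // _.
    by rewrite xc in bx; apply: (based_section_star_edge aE ca yc).
  by rewrite addbC; rewrite yc in by_; apply: (based_section_star_edge aE ca xc).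
- by have := im _ _ bx; have := im _ _ by_; rewrite a0 !inE => -> ->.
- by have := im _ _ bx; have := im _ _ by_; case: eqP => [->|_] //; case: eqP => [->|_].
Qed.

Lemma regular_in_star (M : {set PT 'I_n}) a :
  M \subset PwEnd S -> regular_in M a -> star_regular a.
Proof.
move=> /subsetP ME [b /ME]; rewrite inE => /all_imagesP bE aba.
have [ca | ca] := boolP (c \in pdom a); [by left | right].
have [/existsP[u /eqP au] | cim] := boolP [exists u, a u == Some c]; last first.
  by right; rewrite inE.
left; apply/setP=> y; rewrite !inE; apply/existsP/eqP => [[w /eqP aw] | ->]; last first.
  by exists u; rewrite au.
apply/eqP; apply: contraT => yc.
have [u' bu' au'] := quasi_inverse_im aba au.
have [w' bw' aw'] := quasi_inverse_im aba aw.
have leaf v x : a v = Some x -> (v == c) = false.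
  by move=> av; apply: contraNF ca => /eqP <-; rewrite inE av.
have := bE _ _ _ _ bu' bw'.
rewrite !star_edgeE eqxx (negPf yc) (leaf _ _ au') (leaf _ _ aw') implybF negbK.
(* Two leaves span no edge, so the weak condition merges [u'] and [w'], although [a] sends them to
   [c] and [y]. *)
by move=> /eqP uw; move: aw' yc; rewrite -uw au' => -[->]; rewrite eqxx.
Qed.

End Star.

Theorem theorem2p3 (n : nat) (n_gt0 : 1 <= n) (M : {set PT 'I_n})
    (M_case : M \in [:: PsEnd (star n_gt0); PswEnd (star n_gt0);
                        IEnd (star n_gt0); PEnd (star n_gt0);
                        PwEnd (star n_gt0)])
    (a : PT 'I_n) (a_M : a \in M) :
  regular_in M a <->
  (centre n_gt0 \in pdom a \/ pim a = [set centre n_gt0] \/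
   centre n_gt0 \notin pim a).
Proof.
have M_PwEnd : M \subset PwEnd (star n_gt0).
  move: M_case; rewrite !inE => /or4P[||| /orP[]] /eqP-> //.
  - exact: subset_trans (PsEnd_sub_PEnd _) (PEnd_sub_PwEnd _).
  - exact: PswEnd_sub_PwEnd.
  - exact: subset_trans (IEnd_sub_PEnd _) (PEnd_sub_PwEnd _).
  - exact: PEnd_sub_PwEnd.
split=> [|a_reg]; first exact: regular_in_star.
have bE := based_section_PEnd (subsetP M_PwEnd _ a_M) a_reg.
exists (based_section (centre n_gt0) a); last exact: based_section_quasi_inverse.
(* The two strong classes pass from [a] to its section; the other three follow from [bE]. *)
move: M_case a_M; rewrite !inE => /or4P[||| /orP[]] /eqP-> aM //.
- exact: based_section_PsEnd.
- exact: based_section_PswEnd.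
- exact: based_section_IEnd.
- exact: subsetP (PEnd_sub_PwEnd _) _ bE.
Qed.
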